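(* Let $p$ be a prime, $m\ge1$, $q=p^m$, $\omega=e^{2\pi i/p}$. For $i,j\in\mathbb{F}_p$ let $T_{ij}=|\{x\in\mathbb{F}_q^{*}: tr(x)=i,\ tr(x^{-1})=j\}|$. Consider the linear system in unknowns $t_1,\ldots,t_{p-1}$: $$\sum_{s=1}^{p-1}\big(\mathcal{K}(us)+p+1\big)t_s=\mathcal{K}^{(m)}(u)+q+1,\qquad u\in\mathbb{F}_p^*.$$ This system has a unique solution, and it is $t_s=T_{1s}$, $s=1,\ldots,p-1$.
   Context: $tr:\mathbb{F}_q\to\mathbb{F}_p$ is the absolute trace $tr(\gamma)=\sum_{r=0}^{m-1}\gamma^{p^r}$. For $u\in\mathbb{F}_q^*$, $\mathcal{K}^{(m)}(u)=\sum_{x\in\mathbb{F}_q^*}\omega^{tr(x+u/x)}$ (Kloosterman sum), and $\mathcal{K}(u)=\mathcal{K}^{(1)}(u)$ for $u\in\mathbb{F}_p^*$; products $us$ are computed in $\mathbb{F}_p$. *)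

(* Defs.v *)
From mathcomp Require Import all_boot all_order all_algebra all_field.
From mathcomp Require Import complex.
From mathcomp Require Import reals trigo.

Set Implicit Arguments.
Unset Strict Implicit.
Unset Printing Implicit Defensive.

Import Order.TTheory GRing.Theory Num.Theory.
Local Open Scope ring_scope.

(* e^(2 pi i / p) *)
Definition omega (R : realType) (p : nat) : R[i] :=
  Complex (cos (2 * pi / p%:R)) (sin (2 * pi / p%:R)).

Definition Fp_embed (p : nat) (F : finFieldType) (a : 'F_p) : F :=
  (nat_of_ord a)%:R.
Arguments Fp_embed {p} F a.

Definition trace_sum (p m : nat) (F : finFieldType) (x : F) : F :=
  \sum_(0 <= r < m) x ^+ (p ^ r).

(* The absolute trace as an element of 'F_p: the preimage of [trace_sum] under
   the embedding of the prime field. The default value 0 is never used when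
   p is prime and #|F| = p ^ m, see [Fp_embed_tr]. *)
Definition tr (p m : nat) (F : finFieldType) (x : F) : 'F_p :=
  odflt 0 [pick a : 'F_p | Fp_embed F a == trace_sum p m x].

Definition kloosterman (R : realType) (p m : nat) (F : finFieldType) (u : F) :
    R[i] :=
  \sum_(x : F | x != 0) omega R p ^+ nat_of_ord (tr p m (x + u / x)).

Definition Tcount (p m : nat) (F : finFieldType) (i j : 'F_p) : nat :=
  #|[set x : F | [&& x != 0, tr p m x == i & tr p m x^-1 == j]]|.

(* Only the entries of [t] at nonzero indices are unknowns. *)
Definition kloosterman_system (R : realType) (p m : nat) (F : finFieldType)
    (t : 'F_p -> R[i]) : Prop :=
  forall u : 'F_p, u != 0 ->
    \sum_(s : 'F_p | s != 0)
       (kloosterman R p 1 (u * s) + p%:R + 1) * t s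
    = kloosterman R p m (Fp_embed F u) + (p ^ m)%:R + 1.

Lemma Fp_embed_tr (p m : nat) (F : finFieldType) (x : F) :
  prime p -> #|F| = (p ^ m)%N -> Fp_embed F (tr p m x) = trace_sum p m x.
Proof.
move=> p_pr cardF; have pF := card_finPcharP cardF p_pr.
have m_gt0 : (0 < m)%N.
  by rewrite -(ltn_exp2l _ _ (prime_gt1 p_pr)) -cardF finNzRing_gt1.
have frobD : trace_sum p m x ^+ p = trace_sum p m x.
  rewrite -{1}[_ ^+ p](pFrobenius_autE pF) rmorph_sum /=.
  under eq_bigr => r _ do rewrite pFrobenius_autE -exprM -expnSr.
  rewrite /trace_sum -(prednK m_gt0) big_nat_recr //= big_nat_recl //=.
  by rewrite (prednK m_gt0) -cardF expf_card expn0 expr1 addrC.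
rewrite /tr; case: pickP => [a /eqP //|noa].
pose s := trace_sum p m x :: [seq Fp_embed F a | a : 'F_p].
have XpX_size : size ('X^p - 'X : {poly F}) = p.+1.
  by rewrite size_polyDl ?size_polyXn // size_polyN size_polyX ltnS prime_gt1.
have XpX_neq0 : 'X^p - 'X != 0 :> {poly F} by rewrite -size_poly_eq0 XpX_size.
have embed_inj : injective (@Fp_embed p F).
  have wlog_inj (a b : 'F_p) : (a <= b)%N -> Fp_embed F a = Fp_embed F b -> a = b.
    move=> le_ab /eqP; rewrite eq_sym -subr_eq0 -natrB // -(dvdn_pcharf pF).
    move=> dv; apply/val_inj/eqP; rewrite eqn_leq le_ab /=.
    rewrite -subn_eq0; apply: contraTT dv; rewrite -lt0n => ba_gt0.
    rewrite gtnNdvd // (leq_ltn_trans (leq_subr _ _)) //.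
    by rewrite -{2}(Fp_cast p_pr) ltn_ord.
  move=> a b eq_ab; case: (leqP a b) => [/wlog_inj/(_ eq_ab)//|/ltnW le_ba].
  by rewrite (wlog_inj b a).
have s_uniq : uniq s.
  rewrite /= map_inj_uniq // enum_uniq andbT.
  by apply/mapP=> -[a _ eq_a]; move: (noa a); rewrite eq_a eqxx.
have s_roots : all (root ('X^p - 'X)) s.
  apply/allP=> y; rewrite inE => /predU1P[->|/mapP[a _ ->]].
    by rewrite rootE !hornerE frobD subrr.
  by rewrite rootE !hornerE -(pFrobenius_autE pF) rmorph_nat subrr.
have := max_poly_roots XpX_neq0 s_roots s_uniq.
by rewrite XpX_size /= size_map -cardE card_Fp // ltnn.
Qed.

(* Main.v *)
(* Expanding K^(m)(u) by the values (i, j) of (tr x, tr x^-1), scaling by F_p^*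
   gives T_ij = T_{1,ij} for nonzero i and T_0j = T_10 for nonzero j, so
   K^(m)(u) = T_00 - 2 T_10 + sum_s K(us) T_1s. The constants are eliminated by
   the equidistribution of the trace, which gives the system.
   For uniqueness, let d be in the kernel. Summing over u gives p^2 sum_s d_s = 0,
   hence sum_s K(us) d_s = 0. As K(us) = sum_y w^(uy) w^(s/y), this is a product
   of two Fourier transforms restricted to nonzero frequencies, each of which is
   injective on functions vanishing at 0. *)
Require Import Defs.
From mathcomp Require Import all_boot all_order all_algebra all_field.
From mathcomp Require Import complex.
From mathcomp Require Import reals trigo.
From mathcomp Require Import ring.

Import Order.TTheory GRing.Theory Num.Theory.
Set Implicit Arguments.
Unset Strict Implicit.
Unset Printing Implicit Defensive.

Local Open Scope ring_scope.

(** * Additive characters of the prime field and Fourier inversion *)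

Lemma omegaX (R : realType) (p n : nat) (a := n%:R * (2 * pi / p%:R) : R) :
  omega R p ^+ n = Complex (cos a) (sin a).
Proof.
rewrite /a {a}; elim: n => [|n IHn]; first by rewrite expr0 mul0r cos0 sin0.
rewrite exprSr IHn -[in RHS]natr1 (mulrDl n%:R) (mul1r (_ / _)) cosD sinD.
by congr Complex; rewrite addrC.
Qed.

Lemma omega_exp_order (R : realType) (p : nat) :
  (0 < p)%N -> omega R p ^+ p = 1.
Proof.
move=> p_gt0; rewrite omegaX mulrC divfK ?pnatr_eq0 -?lt0n //.
by rewrite mulr_natl cos2pi sin_mulr2n sinpi mulr0 mul0rn.
Qed.

Lemma omega_neq1 (R : realType) (p : nat) : (1 < p)%N -> omega R p != 1.
Proof.
move=> p_gt1; have p_gt0 := ltnW p_gt1.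
(* Since cos(2a) = 1 - 2 sin(a)^2 with a = pi/p, the equation omega = 1 would force sin(pi/p) =
   0. *)
have : 0 < sin (pi / p%:R : R).
  apply: sin_gt0_pi; rewrite divr_gt0 ?pi_gt0 ?ltr0n //=.
  by rewrite ltr_pdivrMr ?ltr0n // ltr_pMr ?pi_gt0 ?ltr1n.
apply: contraTneq => -[cos1 _]; move: cos1.
rewrite -mulrA mulr_natl cos_mulr2n cos2sin2 => /eqP.
rewrite mulrnBl addrAC [1 *+ 2]mulr2n addrK -subr_eq0 addrAC subrr sub0r.
by rewrite oppr_eq0 mulrn_eq0 /= expf_eq0 /= => /eqP ->; rewrite ltxx.
Qed.

Definition add_char (R : realType) (p : nat) (a : 'F_p) : R[i] :=
  omega R p ^+ nat_of_ord a.

Lemma add_charD (R : realType) (p : nat) (a b : 'F_p) : prime p ->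
  add_char R (a + b) = add_char R a * add_char R b.
Proof.
move=> p_pr; rewrite /add_char -exprD /= [X in (_ %% X)%N](Fp_cast p_pr).
by rewrite expr_mod // omega_exp_order ?prime_gt0.
Qed.

Lemma add_char0 (R : realType) (p : nat) : add_char R (0 : 'F_p) = 1.
Proof. by rewrite /add_char /= expr0. Qed.

Lemma sum_add_char (R : realType) (p : nat) (a : 'F_p) : prime p ->
  \sum_x add_char R (a * x) = if a == 0 then p%:R else 0.
Proof.
move=> p_pr; case: eqP => [->|/eqP a_neq0].
  under eq_bigr do rewrite mul0r add_char0.
  by rewrite sumr_const card_Fp.
rewrite -(reindex_inj (mulfI a_neq0) (P := predT)
  (F := @add_char R p)) /=.
have char1 : add_char R (1 : 'F_p) != 1.
  have ->: add_char R (1 : 'F_p) = omega R p ^+ 1%N by [].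
  by rewrite expr1 omega_neq1 ?prime_gt1.
(* Shifting the index by 1 multiplies the sum by [add_char R 1], which differs from 1; so the sum
   vanishes. *)
apply: (mulfI (_ : add_char R (1 : 'F_p) - 1 != 0)); first by rewrite subr_eq0.
rewrite mulr0 mulrBl mul1r mulr_sumr [X in _ - X](reindex_inj (addrI 1)) /=.
by under [X in _ - X]eq_bigr do rewrite add_charD //; rewrite subrr.
Qed.

Lemma sum_add_char_neq0 (R : realType) (p : nat) (a : 'F_p) : prime p ->
  a != 0 -> \sum_(x | x != 0) add_char R (a * x) = -1.
Proof.
move=> p_pr /negPf a_neq0; apply/eqP; rewrite -subr_eq0 opprK addrC.
have := sum_add_char R a p_pr; rewrite a_neq0 (bigD1 0) //= mulr0 add_char0.
by move=> ->.
Qed.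

(** Extend g by 0 at y = 0. Only the frequency u = 0 survives in the inversion formula, so the
    extended function is constant, and its value at 0 is 0. *)
Lemma fourier_neq0_inj (R : realType) (p : nat) (g : 'F_p -> R[i]) : prime p ->
  (forall u, u != 0 -> \sum_(y | y != 0) add_char R (u * y) * g y = 0) ->
  forall y, y != 0 -> g y = 0.
Proof.
move=> p_pr g_hat0.
have inversion s :
    p%:R * (if s == 0 then 0 else g s) = \sum_(y | y != 0) g y.
  have: \sum_u add_char R (u * - s) *
      \sum_(y | y != 0) add_char R (u * y) * g y = \sum_(y | y != 0) g y.
    rewrite (bigD1 0) //= mul0r add_char0 mul1r [X in _ + X]big1 ?addr0.
      by apply: eq_bigr => y _; rewrite mul0r add_char0 mul1r.
    by move=> u u_neq0; rewrite g_hat0 // mulr0.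
  move=> <-; under eq_bigr do rewrite mulr_sumr.
  rewrite exchange_big /=.
  under eq_bigr => y _.
    under eq_bigr => u _ do
      rewrite mulrA -add_charD // -mulrDr [u * _]mulrC.
    rewrite -mulr_suml sum_add_char // addrC subr_eq0.
    over.
  case: eqP => [->|/eqP s_neq0].
    by rewrite mulr0 big1 // => y /negPf ->; rewrite mul0r.
  rewrite (bigD1 s) //= eqxx [X in _ + X]big1 ?addr0 //.
  by move=> y /andP[_ /negPf ->]; rewrite mul0r.
(* The right-hand side of [inversion] does not depend on s, so compare s = y with s = 0. *)
move=> y y_neq0; have := inversion y.
rewrite -(inversion 0) eqxx mulr0 (negPf y_neq0) => /eqP.
by rewrite mulf_eq0 pnatr_eq0 -leqn0 leqNgt prime_gt0 //= => /eqP.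
Qed.

(** * The prime field inside F, and the distribution of the trace *)

Lemma embed_natr (p : nat) (F : finFieldType) (n : nat) : prime p ->
  p \in [pchar F] -> Fp_embed F (n%:R : 'F_p) = n%:R.
Proof.
by move=> p_pr pF; rewrite /Fp_embed val_Fp_nat // GRing.natr_mod_pchar.
Qed.

Lemma embedD (p : nat) (F : finFieldType) (a b : 'F_p) : prime p ->
  p \in [pchar F] -> Fp_embed F (a + b) = Fp_embed F a + Fp_embed F b.
Proof.
move=> p_pr pF.
by rewrite -[a in LHS]natr_Zp -[b in LHS]natr_Zp -natrD embed_natr // natrD.
Qed.

Lemma embedM (p : nat) (F : finFieldType) (a b : 'F_p) : prime p ->
  p \in [pchar F] -> Fp_embed F (a * b) = Fp_embed F a * Fp_embed F b.
Proof.
move=> p_pr pF.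
by rewrite -[a in LHS]natr_Zp -[b in LHS]natr_Zp -natrM embed_natr // natrM.
Qed.

Lemma embed_eq0 (p : nat) (F : finFieldType) (a : 'F_p) : prime p ->
  p \in [pchar F] -> (Fp_embed F a == 0) = (a == 0).
Proof.
move=> p_pr pF; rewrite /Fp_embed -(dvdn_pcharf pF).
have lt_ap : (a < p)%N by rewrite -[X in (_ < X)%N](Fp_cast p_pr) ltn_ord.
by rewrite /dvdn modn_small.
Qed.

Lemma embed_inj (p : nat) (F : finFieldType) : prime p ->
  p \in [pchar F] -> injective (@Fp_embed p F).
Proof.
move=> p_pr pF a b eq_ab; apply/eqP; rewrite -subr_eq0 -(embed_eq0 _ p_pr pF).
apply/eqP/(addIr (Fp_embed F b)); rewrite -embedD // subrK add0r //.
Qed.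

Lemma embedV (p : nat) (F : finFieldType) (a : 'F_p) : prime p ->
  p \in [pchar F] -> a != 0 -> Fp_embed F a^-1 = (Fp_embed F a)^-1.
Proof.
move=> p_pr pF a_neq0.
have ea_neq0 : Fp_embed F a != 0 by rewrite embed_eq0.
by apply: (mulfI ea_neq0); rewrite -embedM // !divff.
Qed.

Lemma embed_expp (p : nat) (F : finFieldType) (a : 'F_p) (r : nat) :
  p \in [pchar F] -> Fp_embed F a ^+ (p ^ r) = Fp_embed F a.
Proof.
move=> pF; elim: r => [|r IHr]; first by rewrite expr1.
by rewrite expnSr exprM IHr -(pFrobenius_autE pF) rmorph_nat.
Qed.

Lemma trD (p m : nat) (F : finFieldType) (x y : F) :
  prime p -> #|F| = (p ^ m)%N -> tr p m (x + y) = tr p m x + tr p m y.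
Proof.
move=> p_pr cardF; have pF := card_finPcharP cardF p_pr.
apply: (@embed_inj p F p_pr pF).
rewrite embedD // !Fp_embed_tr // /trace_sum -big_split /=.
apply: eq_bigr => r _; apply: exprDn_pchar.
by rewrite pnatX pnatE // pF.
Qed.

Lemma tr_embedM (p m : nat) (F : finFieldType) (a : 'F_p) (x : F) :
  prime p -> #|F| = (p ^ m)%N -> tr p m (Fp_embed F a * x) = a * tr p m x.
Proof.
move=> p_pr cardF; have pF := card_finPcharP cardF p_pr.
apply: (@embed_inj p F p_pr pF).
rewrite embedM // !Fp_embed_tr // /trace_sum mulr_sumr.
by apply: eq_bigr => r _; rewrite exprMn embed_expp.
Qed.

Lemma tr0 (p m : nat) (F : finFieldType) :
  prime p -> #|F| = (p ^ m)%N -> tr p m (0 : F) = 0.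
Proof.
move=> p_pr cardF; apply: (addIr (tr p m (0 : F))).
by rewrite -trD // !add0r.
Qed.

(* The trace is a polynomial function of degree [p ^ (m - 1)], less than [#|F|],
   so it has a nonzero value, which can be scaled to 1. *)
Lemma tr_eq1_exists (p m : nat) (F : finFieldType) :
  prime p -> #|F| = (p ^ m)%N -> exists x : F, tr p m x = 1.
Proof.
move=> p_pr cardF; have pF := card_finPcharP cardF p_pr.
have m_gt0 : (0 < m)%N.
  by rewrite -(ltn_exp2l _ _ (prime_gt1 p_pr)) -cardF finNzRing_gt1.
have [x tr_neq0|tr_eq0] := pickP (fun x : F => tr p m x != 0).
  exists (Fp_embed F (tr p m x)^-1 * x).
  by rewrite tr_embedM // mulVf.
pose P : {poly F} := \sum_(0 <= r < m) 'X^(p ^ r).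
have size_P : (size P <= (p ^ m.-1).+1)%N.
  rewrite /P big_mkord; apply: leq_trans (size_sum _ _ _) _.
  apply/bigmax_leqP => r _; rewrite size_polyXn ltnS.
  by rewrite leq_exp2l ?prime_gt1 // -ltnS prednK.
have P_neq0 : P != 0.
  (* The coefficient of X is 1: it comes from r = 0 alone, because p^r > 1 for r > 0. *)
  apply/eqP => /(congr1 (fun Q : {poly F} => Q`_1)) /eqP.
  rewrite coef0 /P -(prednK m_gt0) big_nat_recl //= coefD coefXn expn0 eqxx.
  rewrite coef_sum big1 ?addr0 ?oner_eq0 // => r _.
  by rewrite coefXn eq_sym -(expn0 p) eqn_exp2l ?prime_gt1.
have P_roots : all (root P) (enum F).
  apply/allP => x _; rewrite rootE horner_sum.
  under eq_bigr do rewrite hornerXn.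
  rewrite -/(trace_sum p m x) -Fp_embed_tr // embed_eq0 //.
  exact/negbFE/tr_eq0.
have := max_poly_roots P_neq0 P_roots (enum_uniq F).
rewrite -cardE cardF ltnNge => /negP[].
apply: (leq_trans size_P).
by rewrite ltn_exp2l ?prime_gt1 // prednK.
Qed.

(** Adding a prime-field multiple of an element of trace 1 maps any fibre bijectively onto any
    other, so the p fibres share F equally. *)
Lemma card_tr_fiber (p m : nat) (F : finFieldType) (i : 'F_p) :
  prime p -> #|F| = (p ^ m)%N ->
  (#|[set x : F | tr p m x == i]| * p = p ^ m)%N.
Proof.
move=> p_pr cardF; have pF := card_finPcharP cardF p_pr.
have [x1 tr_x1] := tr_eq1_exists p_pr cardF.
have fiber j : #|[set x : F | tr p m x == j]| = #|[set x : F | tr p m x == i]|.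
  rewrite -(card_imset _ (addrI (Fp_embed F (i - j) * x1))).
  apply: eq_card => y; rewrite inE; apply/imsetP/eqP => [[x]|tr_y].
    rewrite inE => /eqP tr_x ->.
    by rewrite trD // tr_embedM // tr_x1 mulr1 tr_x subrK.
  exists (Fp_embed F (j - i) * x1 + y).
    by rewrite inE trD // tr_embedM // tr_x1 mulr1 tr_y subrK.
  rewrite addrA -mulrDl -embedD // addrA subrK subrr.
  by rewrite /Fp_embed mul0r add0r.
rewrite -cardF -[RHS]sum1_card [RHS](partition_big (@tr p m F) predT) //=.
rewrite (eq_bigr (fun=> #|[set x : F | tr p m x == i]|)) => [|j _].
  by rewrite sum_nat_const card_Fp // mulnC.
by rewrite sum1dep_card -(fiber j); apply: eq_card => x; rewrite !inE.
Qed.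

(** * Symmetries and row sums of the counts T_ij *)

Lemma TcountC (p m : nat) (F : finFieldType) (i j : 'F_p) :
  Tcount m F i j = Tcount m F j i.
Proof.
rewrite /Tcount -(card_imset _ invr_inj); apply: eq_card => y.
rewrite inE; apply/imsetP/and3P => [[x]|[y_neq0 tr_y tr_yV]].
  by rewrite inE => /and3P[x_neq0 tr_x tr_xV] ->; rewrite invr_eq0 invrK.
by exists y^-1; rewrite ?invrK // inE invr_eq0 invrK; apply/and3P.
Qed.

(** The trace is linear over the prime field, so x -> cx multiplies tr(x) by c and divides tr(1/x)
    by c. *)
Lemma Tcount_scale (p m : nat) (F : finFieldType) (c i j : 'F_p) :
  prime p -> #|F| = (p ^ m)%N -> c != 0 ->
  Tcount m F (c * i) (j / c) = Tcount m F i j.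
Proof.
move=> p_pr cardF c_neq0; have pF := card_finPcharP cardF p_pr.
have ec_neq0 : Fp_embed F c != 0 by rewrite embed_eq0.
rewrite /Tcount -[RHS](card_imset _ (mulfI ec_neq0)); apply: eq_card => y.
rewrite inE; apply/and3P/imsetP => [[y_neq0 /eqP tr_y /eqP tr_yV]|[x]].
  exists (Fp_embed F c^-1 * y); last first.
    by rewrite mulrA embedV // divff ?mul1r.
  rewrite inE mulf_neq0 ?embed_eq0 ?invr_eq0 //= invfM -embedV ?invr_eq0 //.
  rewrite invrK !tr_embedM // tr_y tr_yV mulKf // mulrCA divff // mulr1.
  by rewrite !eqxx.
rewrite inE => /and3P[x_neq0 /eqP tr_x /eqP tr_xV] ->.
rewrite mulf_neq0 // invfM -embedV // !tr_embedM // tr_x tr_xV.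
by rewrite [c^-1 * _]mulrC !eqxx.
Qed.

(** Sort the trace fibre over i by the value of tr(1/x). The summand [i == 0] restores x = 0, which
    has trace 0 but is excluded from the counts. *)
Lemma sum_Tcount (p m : nat) (F : finFieldType) (i : 'F_p) :
  prime p -> #|F| = (p ^ m)%N ->
  ((\sum_j Tcount m F i j + (i == 0%R)) * p = p ^ m)%N.
Proof.
move=> p_pr cardF; rewrite -(card_tr_fiber i p_pr cardF); congr (_ * _)%N.
rewrite (cardsD1 0) inE tr0 // eq_sym addnC; congr (_ + _)%N.
rewrite -[RHS]sum1_card [RHS](partition_big (fun x : F => tr p m x^-1) predT) //=.
apply: eq_bigr => j _; rewrite sum1dep_card /Tcount.
by apply: eq_card => x; rewrite !inE -andbA.
Qed.

(** * Kloosterman sums in terms of T_ij, and existence of the solution *)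

Lemma tr_Fp (p : nat) (x : 'F_p) : prime p -> tr p 1 x = x.
Proof.
move=> p_pr; have cardFp : #|'F_p| = (p ^ 1)%N by rewrite card_Fp.
have := Fp_embed_tr x p_pr cardFp.
by rewrite /trace_sum big_nat1 expr1 /Fp_embed natr_Zp.
Qed.

Lemma kloosterman_Fp (R : realType) (p : nat) (a : 'F_p) : prime p ->
  kloosterman R p 1 a = \sum_(x | x != 0) add_char R (x + a / x).
Proof. by move=> p_pr; apply: eq_bigr => x _; rewrite tr_Fp. Qed.

Lemma kloosterman_Tcount (R : realType) (p m : nat) (F : finFieldType)
    (u : 'F_p) : prime p -> #|F| = (p ^ m)%N ->
  kloosterman R p m (Fp_embed F u)
  = \sum_i \sum_j (Tcount m F i j)%:R * add_char R (i + u * j).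
Proof.
move=> p_pr cardF.
rewrite /kloosterman (partition_big (@tr p m F) predT) //=.
apply: eq_bigr => i _.
rewrite (partition_big (fun x : F => tr p m x^-1) predT) //=.
apply: eq_bigr => j _.
rewrite (eq_bigr (fun=> add_char R (i + u * j))) => [|x].
  rewrite sumr_const mulr_natl; congr (_ *+ _).
  by apply: eq_card => x; rewrite !inE unfold_in -!andbA.
case/andP=> /andP[_ /eqP <-] /eqP <-.
by rewrite /add_char trD // tr_embedM.
Qed.

Lemma Tcount_system (R : realType) (p m : nat) (F : finFieldType) :
  prime p -> #|F| = (p ^ m)%N ->
  kloosterman_system m F (fun s : 'F_p => (Tcount m F 1 s)%:R : R[i]).
Proof.
move=> p_pr cardF u u_neq0; rewrite kloosterman_Tcount //.
pose T (i j : 'F_p) : R[i] := (Tcount m F i j)%:R.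
have Ti0 i : i != 0 -> T i 0 = T 1 0.
  move=> i_neq0.
  by rewrite /T -(Tcount_scale 1 0 p_pr cardF i_neq0) mulr1 mul0r.
have T0j j : j != 0 -> T 0 j = T 1 0.
  by move=> j_neq0; rewrite /T TcountC -/(T j 0) Ti0.
have Tij i s : i != 0 -> T i (s / i) = T 1 s.
  by move=> i_neq0; rewrite /T -(Tcount_scale 1 s p_pr cardF i_neq0) mulr1.
have rhs : \sum_i \sum_j T i j * add_char R (i + u * j)
    = T 0 0 - T 1 0 *+ 2
      + \sum_(s | s != 0) kloosterman R p 1 (u * s) * T 1 s.
  (* A nontrivial character sums to -1 over nonzero arguments: the row i = 0 gives T_00 - T_10, and
     the rest of the column j = 0 gives another -T_10. *)
  rewrite (bigD1 0) //= (bigD1 0) //= mulr0 addr0 add_char0 mulr1.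
  under eq_bigr => j j_neq0 do rewrite T0j // add0r.
  rewrite -mulr_sumr sum_add_char_neq0 // mulrN1.
  under [X in _ + X = _]eq_bigr => i i_neq0 do
    rewrite (bigD1 0) //= mulr0 addr0 Ti0 //.
  rewrite big_split /= -mulr_sumr.
  under [X in _ * X]eq_bigr => i _ do rewrite -[i in add_char _ i]mul1r.
  rewrite sum_add_char_neq0 ?oner_neq0 // mulrN1 addrA mulr2n opprD addrA.
  congr (_ + _).
  under [RHS]eq_bigr => s _ do rewrite kloosterman_Fp // mulr_suml.
  rewrite [RHS]exchange_big /=; apply: eq_bigr => i i_neq0.
  (* Substituting j = s/i turns i + uj into i + us/i, the exponent in K(us), and T_ij into T_1s. *)
  rewrite (reindex_inj (mulIf (_ : i^-1 != 0))) ?invr_eq0 //=.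
  apply: eq_big => [s|s _].
    by rewrite mulf_eq0 invr_eq0 (negPf i_neq0) orbF.
  by rewrite Tij // mulrC mulrA.
rewrite rhs.
have p_neq0 : p%:R != 0 :> R[i] by rewrite pnatr_eq0 -lt0n prime_gt0.
have cardT i : (\sum_j T i j + (i == 0)%:R) * p%:R = (p ^ m)%:R.
  by rewrite -(sum_Tcount i p_pr cardF) natrM natrD natr_sum.
(* Rows 1 and 0 have the same total once x = 0 is added to row 0. Comparing them gives [S_eq], that
   is S = T_00 + (p - 2) T_10 + 1, and row 1 expresses p^m as p (T_10 + S). *)
have card1 := cardT 1; have card0 := cardT 0.
rewrite oner_eq0 addr0 (bigD1 0) //= in card1.
rewrite eqxx (bigD1 0) //= (eq_bigr (fun=> T 1 0)) // in card0.
rewrite sumr_const cardC1 card_Fp // in card0.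
have natp : p%:R = p.-1%:R + 1 :> R[i] by rewrite natr1 prednK ?prime_gt0.
under eq_bigr => s _ do rewrite -addrA mulrDl.
rewrite big_split /= -mulr_sumr.
set S := \sum_(s | s != 0) T 1 s in card1 *.
have S_eq : S = T 0 0 + T 1 0 *+ p.-1 + 1 - T 1 0.
  by apply/(addrI (T 1 0))/(mulIf p_neq0); rewrite card1 -card0; ring.
rewrite -card1 -mulr_natr in S_eq *.
rewrite natp; ring: S_eq.
Qed.

(** * Uniqueness of the solution *)

Lemma kloosterman_system_inj (R : realType) (p : nat) (d : 'F_p -> R[i]) :
  prime p ->
  (forall u : 'F_p, u != 0 ->
     \sum_(s | s != 0) (kloosterman R p 1 (u * s) + p%:R + 1) * d s = 0) ->
  forall s, s != 0 -> d s = 0.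
Proof.
move=> p_pr d_ker.
have sumK (s : 'F_p) : s != 0 -> \sum_(u | u != 0) kloosterman R p 1 (u * s) = 1.
  move=> s_neq0; under eq_bigr do rewrite kloosterman_Fp //.
  rewrite exchange_big /=.
  (* For fixed x, the sum over u of w^(us/x) is -1; the remaining sum of -w^x over nonzero x is
     1. *)
  rewrite (eq_bigr (fun x => - add_char R (1 * x))) => [|x x_neq0].
    by rewrite sumrN sum_add_char_neq0 ?oner_neq0 // opprK.
  under eq_bigr => u _ do rewrite add_charD // -mulrA [u * _]mulrC.
  by rewrite -mulr_sumr sum_add_char_neq0 ?mulf_neq0 ?invr_eq0 // mulrN1 mul1r.
have sum_d : \sum_(s | s != 0) d s = 0.
  have p2_neq0 : p%:R * p%:R != 0 :> R[i].
    by rewrite mulf_neq0 // pnatr_eq0 -lt0n prime_gt0.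
  apply: (mulfI p2_neq0); rewrite mulr0.
  transitivity (\sum_(u : 'F_p | u != 0)
      \sum_(s | s != 0) (kloosterman R p 1 (u * s) + p%:R + 1) * d s).
    2: exact: big1.
  rewrite exchange_big /= mulr_sumr; apply: eq_bigr => s s_neq0.
  rewrite -mulr_suml; congr (_ * _).
  (* The coefficients of d_s over all u add up to 1 + (p - 1)(p + 1) = p^2. *)
  under eq_bigr do rewrite -addrA.
  rewrite big_split /= sumK // sumr_const cardC1 card_Fp // -mulr_natr.
  by rewrite -(prednK (prime_gt0 p_pr)) -natr1 /=; ring.
have kloosterman_factor (u s : 'F_p) : s != 0 -> kloosterman R p 1 (u * s)
    = \sum_(y | y != 0) add_char R (u * y) * add_char R (y^-1 * s).
  move=> s_neq0; rewrite kloosterman_Fp //.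
  have sK (y : 'F_p) : s / (s / y) = y.
    by rewrite invf_div mulrCA divff ?mulr1.
  (* The substitution x = s/y is an involution on nonzero elements and turns x + us/x into s/y + uy.
     As 0^-1 = 0, the value y = 0 is excluded by the condition on s/y. *)
  rewrite (reindex_onto (fun y => s / y) (fun y => s / y)) => [|y] //=.
  apply: eq_big => [y|y /andP[sy_neq0 _]].
    have [->|y_neq0] := eqVneq y 0; first by rewrite invr0 mulr0 eqxx.
    by rewrite sK eqxx mulf_neq0 ?invr_eq0.
  have y_neq0 : y != 0 by apply: contraNneq sy_neq0 => ->; rewrite invr0 mulr0.
  by rewrite -mulrA sK addrC add_charD // [_ * s]mulrC.
have dual_d (y : 'F_p) : y != 0 -> \sum_(s | s != 0) add_char R (y^-1 * s) * d s = 0.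
  (* First inversion, in y. The constant p + 1 drops out of the kernel equations by [sum_d]. *)
  move: y; apply: fourier_neq0_inj => // u u_neq0.
  rewrite -[RHS](d_ker u u_neq0).
  under [RHS]eq_bigr do rewrite -addrA mulrDl.
  rewrite big_split /= -mulr_sumr sum_d mulr0 addr0.
  under eq_bigr do rewrite mulr_sumr.
  rewrite exchange_big /=; apply: eq_bigr => s s_neq0.
  rewrite kloosterman_factor // mulr_suml.
  by apply: eq_bigr => y _; rewrite mulrA.
(* Second inversion, in s: every nonzero frequency z has the form 1/y. *)
apply: fourier_neq0_inj => // z z_neq0.
by rewrite -[RHS](dual_d z^-1) ?invr_eq0 // invrK.
Qed.

Theorem theorem1 (R : realType) (p m : nat) (F : finFieldType)
    (p_prime : prime p) (m_gt0 : (0 < m)%N) (cardF : #|F| = (p ^ m)%N) :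
  kloosterman_system m F (fun s : 'F_p => (Tcount m F 1 s)%:R : R[i]) /\
  (forall t : 'F_p -> R[i], kloosterman_system m F t ->
     forall s : 'F_p, s != 0 -> t s = (Tcount m F 1 s)%:R).
Proof.
have T_sol := @Tcount_system R p m F p_prime cardF; split=> // t t_sol s s_neq0.
apply/eqP; rewrite -subr_eq0; apply/eqP; move: s s_neq0.
apply: kloosterman_system_inj => // u u_neq0.
under eq_bigr do rewrite mulrBr.
by rewrite sumrB t_sol // T_sol // subrr.
Qed.
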